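(* Let $G$ be a (discrete) group satisfying the following condition: for all finite non-empty subsets $H\subset G$ with $e\notin H$ and for all positive integers $n$ there are $r,s\in G$ and a set $\{c_1,c_2,\ldots,c_n\}\subset C_G(sr)$ such that the set $\{c_k(sgr)c_k^{-1}: k=1,\ldots,n\}$ is free for all $g\in H$. Then the reduced $C^*$-algebra $C^*_\lambda(G)$ is simple.
   Context: $C_G(x)$ denotes the centralizer of $x$ in $G$ and $e$ the identity. A set $\{g_1,\ldots,g_n\}$ of $n$ elements of a group is called free if $g_1,\ldots,g_n$ are standard (free) generators of a free group of rank $n$, i.e. they freely generate the subgroup they generate. $C^*_\lambda(G)$ is the norm closure of the span of $\lambda(G)$ in $B(\ell^2(G))$, where $\lambda$ is the left regular representation; simple means it has no nontrivial proper closed two-sided ideals. *)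

(* Defs.v *)
From HB Require Import structures.
From mathcomp Require Import all_boot all_order all_algebra.
From mathcomp Require Import ring lra complex.
From mathcomp Require Import all_classical all_reals all_analysis.

Set Implicit Arguments.
Unset Strict Implicit.
Unset Printing Implicit Defensive.

Import Order.TTheory GRing.Theory Num.Theory.
Import numFieldNormedType.Exports.

Local Open Scope classical_set_scope.
Local Open Scope ring_scope.
Local Open Scope complex_scope.

Local Notation normc := ComplexField.Normc.normc.

Lemma normc_ge0 (R : realType) (z : R[i]) : 0 <= normc z.
Proof. by case: z => a b; rewrite sqrtr_ge0. Qed.

Lemma ge0_esumZl (R : realType) (T : choiceType) (c : R) (a : T -> \bar R) :
  0 <= c -> (forall x, 0 <= a x)%E ->
  (\esum_(x in [set: T]) (c%:E * a x) = c%:E * \esum_(x in [set: T]) a x)%E.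
Proof.
move=> c0 a0; rewrite /esum -ereal_supZl//; last first.
  by apply/set0P; exists 0%E; exists set0; [exact: fsets_set0|rewrite fsbig_set0].
congr ereal_sup; rewrite image_comp; apply: eq_imagel => A [finA _] /=.
by rewrite ge0_mule_fsumr.
Qed.

Section SquareSummable.
Context (R : realType) (G : choiceType).
Implicit Types f g : G -> R[i].

Definition sqnorm f : \bar R :=
  (\esum_(x in [set: G]) (normc (f x) ^+ 2)%:E)%E.

Definition square_summable : {pred G -> R[i]} :=
  [pred f | `[< (sqnorm f < +oo)%E >]].

Lemma sqnorm_ge0 f : (0 <= sqnorm f)%E.
Proof. by apply: esum_ge0 => x _; rewrite lee_fin sqr_ge0. Qed.

Lemma sqnormZ (a : R[i]) f :
  sqnorm (a *: f) = ((normc a ^+ 2)%:E * sqnorm f)%E.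
Proof.
rewrite /sqnorm -ge0_esumZl ?sqr_ge0//; last first.
  by move=> x; rewrite lee_fin sqr_ge0.
apply: eq_esum => x _; rewrite -EFinM -exprMn.
by rewrite -ComplexField.Normc.normcM.
Qed.

(* for t > 0, |a + b|^2 <= (1 + t)|a|^2 + (1 + 1/t)|b|^2 *)
Lemma sqnormD_le f g (t : R) : 0 < t ->
  (sqnorm (f + g)%R <=
   (1 + t)%:E * sqnorm f + (1 + t^-1)%:E * sqnorm g)%E.
Proof.
move=> t0; have ti0 : 0 < t^-1 by rewrite invr_gt0.
rewrite /sqnorm -!ge0_esumZl ?addr_ge0 ?(ltW t0) ?(ltW ti0)//;
  do ?by move=> x; rewrite lee_fin sqr_ge0.
rewrite -esumD; do ?by move=> x _;
  rewrite mule_ge0// lee_fin ?sqr_ge0 ?addr_ge0 ?(ltW t0) ?(ltW ti0).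
apply: le_esum => x _; rewrite -!EFinM -EFinD lee_fin.
have h : normc (f x + g x) <= normc (f x) + normc (g x) by exact: le_normcD.
apply: (@le_trans _ _ ((normc (f x) + normc (g x)) ^+ 2)).
  by rewrite ler_sqr ?nnegrE ?addr_ge0 ?normc_ge0.
set u := normc (f x); set v := normc (g x).
rewrite -subr_ge0.
have -> : (1 + t) * u ^+ 2 + (1 + t^-1) * v ^+ 2 - (u + v) ^+ 2 =
          t^-1 * (t * u - v) ^+ 2.
  by field; rewrite gt_eqF.
by rewrite mulr_ge0 ?sqr_ge0 ?ltW.
Qed.

Lemma square_summableP f : reflect (sqnorm f < +oo)%E (f \in square_summable).
Proof. by rewrite inE; exact: asboolP. Qed.

Lemma square_summable_submod : submod_closed square_summable.
Proof.
split.
  apply/square_summableP; rewrite /sqnorm esum1// => x _.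
  by rewrite ComplexField.Normc.normc0 expr0n.
move=> a f g /square_summableP fs /square_summableP gs.
apply/square_summableP; apply: (le_lt_trans (sqnormD_le _ _ ltr01)).
have afs : (sqnorm (a *: f) < +oo)%E.
  by rewrite sqnormZ lte_mul_pinfty// lee_fin sqr_ge0.
by rewrite lte_add_pinfty// lte_mul_pinfty// lee_fin addr_ge0// invr_ge0.
Qed.

HB.instance Definition _ :=
  GRing.isSubmodClosed.Build R[i] (G -> R[i]) square_summable
    square_summable_submod.

Record ell2 := Ell2 {
  ell2_fun :> G -> R[i];
  _ : ell2_fun \in square_summable }.

HB.instance Definition _ := [isSub for ell2_fun].
HB.instance Definition _ := [Choice of ell2 by <:].
HB.instance Definition _ := [SubChoice_isSubLmodule of ell2 by <:].

Definition ell2_norm (f : ell2) : R := Num.sqrt (fine (sqnorm f)).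

Implicit Types u v : ell2.

Lemma ell2P u v : u =1 v -> u = v.
Proof. by move=> uv; apply/val_inj/funext. Qed.

Lemma ell2_norm_ge0 u : 0 <= ell2_norm u.
Proof. exact: sqrtr_ge0. Qed.

Lemma sqnormE u : sqnorm u = (ell2_norm u ^+ 2)%:E.
Proof.
rewrite sqr_sqrtr ?fine_ge0 ?sqnorm_ge0// fineK// ge0_fin_numE ?sqnorm_ge0//.
by apply/square_summableP; exact: valP.
Qed.

Lemma ell2_norm0_eq0 u : ell2_norm u = 0 -> u = 0.
Proof.
move=> u0; apply: ell2P => x.
have : ((normc (u x) ^+ 2)%:E <= sqnorm u)%E.
  apply: esum_ge; exists [set x]; last by rewrite fsbig_set1.
  by split=> //; exact: finite_set1.
rewrite sqnormE u0 expr0n lee_fin => ux0.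
have /eqP : normc (u x) ^+ 2 = 0 by apply/eqP; rewrite eq_le ux0 sqr_ge0.
by rewrite sqrf_eq0 => /eqP /ComplexField.Normc.eq0_normc.
Qed.

Lemma ell2_normZ (a : R[i]) u : ell2_norm (a *: u) = normc a * ell2_norm u.
Proof.
apply/eqP; rewrite -(eqrXn2 (_ : 0 < 2)%N) ?mulr_ge0 ?normc_ge0 ?ell2_norm_ge0//.
by rewrite -eqe -sqnormE exprMn EFinM -sqnormE -sqnormZ.
Qed.

Lemma ell2_normD u v : ell2_norm (u + v) <= ell2_norm u + ell2_norm v.
Proof.
have [/ell2_norm0_eq0->|u0] := eqVneq (ell2_norm u) 0.
  by rewrite add0r lerDr ell2_norm_ge0.
have [/ell2_norm0_eq0->|v0] := eqVneq (ell2_norm v) 0.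
  by rewrite addr0 lerDl ell2_norm_ge0.
have {}u0 : 0 < ell2_norm u by rewrite lt_def u0 ell2_norm_ge0.
have {}v0 : 0 < ell2_norm v by rewrite lt_def v0 ell2_norm_ge0.
rewrite -ler_sqr ?nnegrE ?addr_ge0 ?ell2_norm_ge0//.
rewrite -lee_fin -sqnormE.
have t0 : 0 < ell2_norm v / ell2_norm u by rewrite divr_gt0.
apply: le_trans (sqnormD_le _ _ t0) _.
rewrite !sqnormE -!EFinM -EFinD lee_fin le_eqVlt; apply/orP; left; apply/eqP.
by field; rewrite !gt_eqF.
Qed.

Definition ell2_normC (u : ell2) : R[i] := (ell2_norm u)%:C.

Lemma ell2_normCD u v : ell2_normC (u + v) <= ell2_normC u + ell2_normC v.
Proof. by rewrite -rmorphD lecR ell2_normD. Qed.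

Lemma ell2_normCZ (a : R[i]) u : ell2_normC (a *: u) = `|a| * ell2_normC u.
Proof. by rewrite /ell2_normC ell2_normZ rmorphM. Qed.

Lemma ell2_normC0_eq0 u : ell2_normC u = 0 -> u = 0.
Proof. by move=> /(congr1 (@complex.Re R)) /ell2_norm0_eq0. Qed.

HB.instance Definition _ := Lmodule_isNormed.Build R[i] ell2
  ell2_normCD ell2_normCZ ell2_normC0_eq0.

Lemma ell2_normE u : `|u| = (ell2_norm u)%:C.
Proof. by []. Qed.

End SquareSummable.

Definition linear_span (K : pzRingType) (W : lmodType K) (S : set W) : set W :=
  [set T | exists (m : nat) (a : 'I_m -> K) (s : 'I_m -> W),
    (forall i, S (s i)) /\ T = \sum_(i < m) a i *: s i].

Section BoundedOperators.
Context (R : realType) (G : choiceType).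
Local Notation V := (ell2 R G).

Definition bounded_linear : {pred V -> V} :=
  [pred T | `[< linear T /\
    exists M : R, forall f, ell2_norm (T f) <= M * ell2_norm f >]].

Lemma bounded_linearP (T : V -> V) :
  reflect (linear T /\
      exists M : R, forall f, ell2_norm (T f) <= M * ell2_norm f)
    (T \in bounded_linear).
Proof. by rewrite inE; exact: asboolP. Qed.

Lemma bounded_linear_submod : submod_closed bounded_linear.
Proof.
split.
  apply/bounded_linearP; split.
    by move=> a f g; rewrite scaler0 addr0.
  exists 0 => f; rewrite mul0r.
  by rewrite -[leLHS]/(ell2_norm (0 : V)) -(scale0r (0 : V)) ell2_normZ
    ComplexField.Normc.normc0 mul0r.
move=> a S T /bounded_linearP[Sl [M SM]] /bounded_linearP[Tl [N TN]].
apply/bounded_linearP; split.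
  move=> b f g; rewrite -[LHS]/(a *: S (b *: f + g) + T (b *: f + g)).
  rewrite -[RHS]/(b *: (a *: S f + T f) + (a *: S g + T g)).
  rewrite Sl Tl !scalerDr !scalerA [a * b]mulrC.
  by rewrite -!addrA; congr +%R; rewrite addrCA.
exists (normc a * M + N) => f.
rewrite -[leLHS]/(ell2_norm (a *: S f + T f)) mulrDl.
apply: le_trans (ell2_normD _ _) _; rewrite lerD//.
by rewrite ell2_normZ -mulrA ler_wpM2l ?normc_ge0.
Qed.

HB.instance Definition _ :=
  GRing.isSubmodClosed.Build R[i] (V -> V) bounded_linear
    bounded_linear_submod.

Record bounded_op := BoundedOp {
  bounded_op_fun :> V -> V;
  _ : bounded_op_fun \in bounded_linear }.

HB.instance Definition _ := [isSub for bounded_op_fun].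
HB.instance Definition _ := [Choice of bounded_op by <:].
HB.instance Definition _ := [SubChoice_isSubLmodule of bounded_op by <:].

Implicit Types S T : bounded_op.

Lemma bounded_opP S T : S =1 T -> S = T.
Proof. by move=> ST; apply/val_inj/funext. Qed.

Lemma bounded_op_linear T : linear T.
Proof. by have /bounded_linearP[] := valP T. Qed.

HB.instance Definition _ T :=
  GRing.isLinear.Build R[i] V V *:%R T (@bounded_op_linear T).

Lemma id_bounded : idfun \in bounded_linear.
Proof. by apply/bounded_linearP; split=> //; exists 1 => f; rewrite mul1r. Qed.

Lemma comp_bounded S T : S \o T \in bounded_linear.
Proof.
apply/bounded_linearP; split; first by move=> a f g /=; rewrite !linearP.
have /bounded_linearP[_ [M SM]] := valP S.
have /bounded_linearP[_ [N TN]] := valP T.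
exists (`|M| * `|N|) => f /=; apply: le_trans (SM _) _.
apply: (@le_trans _ _ (`|M| * ell2_norm (T f))).
  by rewrite ler_wpM2r ?ell2_norm_ge0 ?ler_norm.
rewrite -mulrA ler_wpM2l//; apply: le_trans (TN _) _.
by rewrite ler_wpM2r ?ell2_norm_ge0 ?ler_norm.
Qed.

Definition op_id := BoundedOp id_bounded.
Definition op_comp S T := BoundedOp (comp_bounded S T).

Lemma op_compA : associative op_comp.
Proof. by move=> S T U; exact: bounded_opP. Qed.
Lemma op_comp1l : left_id op_id op_comp.
Proof. by move=> T; exact: bounded_opP. Qed.
Lemma op_comp1r : right_id op_id op_comp.
Proof. by move=> T; exact: bounded_opP. Qed.
Lemma op_compDl : left_distributive op_comp +%R.
Proof. by move=> S T U; exact: bounded_opP. Qed.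
Lemma op_compDr : right_distributive op_comp +%R.
Proof. by move=> S T U; apply: bounded_opP => f; exact: (raddfD S). Qed.

HB.instance Definition _ := GRing.Zmodule_isPzRing.Build bounded_op
  op_compA op_comp1l op_comp1r op_compDl op_compDr.

Definition opnorm T : R :=
  sup [set ell2_norm (T f) | f in [set f : V | ell2_norm f <= 1]].

Lemma opnorm_has_sup T :
  has_sup [set ell2_norm (T f) | f in [set f : V | ell2_norm f <= 1]].
Proof.
split.
  exists (ell2_norm (T 0)), 0 => //=.
  by rewrite -(scale0r (0 : V)) ell2_normZ ComplexField.Normc.normc0 mul0r.
have /bounded_linearP[_ [M TM]] := valP T.
exists `|M| => _ [f /= f1 <-]; apply: le_trans (TM _) _.
apply: (@le_trans _ _ (`|M| * ell2_norm f)).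
  by rewrite ler_wpM2r ?ell2_norm_ge0 ?ler_norm.
by rewrite -[leRHS]mulr1 ler_wpM2l.
Qed.

Lemma opnorm_ge0 T : 0 <= opnorm T.
Proof.
apply: le_trans (ell2_norm_ge0 (T 0)) _.
apply: (sup_upper_bound (opnorm_has_sup T)); exists 0 => //=.
by rewrite -(scale0r (0 : V)) ell2_normZ ComplexField.Normc.normc0 mul0r.
Qed.

Lemma le_opnorm T f : ell2_norm (T f) <= opnorm T * ell2_norm f.
Proof.
have [/ell2_norm0_eq0->|f0] := eqVneq (ell2_norm f) 0.
  rewrite linear0 -(scale0r (0 : V)) ell2_normZ.
  by rewrite ComplexField.Normc.normc0 !mul0r mulr0.
have {}f0 : 0 < ell2_norm f by rewrite lt_def f0 ell2_norm_ge0.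
have nV : normc (ell2_norm f)^-1%:C = (ell2_norm f)^-1.
  by rewrite /= expr0n addr0 sqrtr_sqr ger0_norm// invr_ge0 ltW.
rewrite -ler_pdivrMr// mulrC -[X in X * _]nV -ell2_normZ -linearZ/=.
apply: (sup_upper_bound (opnorm_has_sup T)).
exists ((ell2_norm f)^-1%:C *: f) => //=.
by rewrite ell2_normZ nV mulVf ?gt_eqF.
Qed.

Lemma opnorm_le T (M : R) : 0 <= M ->
  (forall f, ell2_norm (T f) <= M * ell2_norm f) -> opnorm T <= M.
Proof.
move=> M0 TM; apply: ge_sup; first by have [] := opnorm_has_sup T.
move=> _ [f /= f1 <-]; apply: le_trans (TM _) _.
by rewrite -[leRHS]mulr1 ler_wpM2l.
Qed.

Definition opnormC T : R[i] := (opnorm T)%:C.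

Lemma opnormCD S T : opnormC (S + T) <= opnormC S + opnormC T.
Proof.
rewrite -rmorphD lecR; apply: opnorm_le; first by rewrite addr_ge0 ?opnorm_ge0.
move=> f; rewrite mulrDl; apply: le_trans (ell2_normD _ _) _.
by rewrite lerD ?le_opnorm.
Qed.

Lemma opnormZ_le (a : R[i]) T : opnorm (a *: T) <= normc a * opnorm T.
Proof.
apply: opnorm_le; first by rewrite mulr_ge0 ?normc_ge0 ?opnorm_ge0.
move=> f; rewrite -[(a *: T) f]/(a *: T f) ell2_normZ -mulrA.
by rewrite ler_wpM2l ?normc_ge0 ?le_opnorm.
Qed.

Lemma opnormCZ (a : R[i]) T : opnormC (a *: T) = `|a| * opnormC T.
Proof.
rewrite -[`|a|]/((normc a)%:C) -rmorphM; congr (_%:C).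
apply/eqP; rewrite eq_le opnormZ_le/=.
have [->|a0] := eqVneq a 0.
  by rewrite ComplexField.Normc.normc0 mul0r opnorm_ge0.
have na0 : 0 < normc a.
  rewrite lt_def normc_ge0 andbT; apply: contra_neq a0.
  exact: ComplexField.Normc.eq0_normc.
rewrite -ler_pdivlMl// -ComplexField.Normc.normcV.
rewrite -[in leLHS](scale1r T) -(mulVf a0) -scalerA.
exact: opnormZ_le.
Qed.

Lemma opnormC0_eq0 T : opnormC T = 0 -> T = 0.
Proof.
move=> /(congr1 (@complex.Re R)) /= T0; apply: bounded_opP => f.
apply: ell2_norm0_eq0; apply/eqP; rewrite eq_le ell2_norm_ge0 andbT.
by rewrite -(mul0r (ell2_norm f)) -T0 le_opnorm.
Qed.

HB.instance Definition _ := Lmodule_isNormed.Build R[i] bounded_op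
  opnormCD opnormCZ opnormC0_eq0.

Lemma opnormE T : `|T| = (opnorm T)%:C.
Proof. by []. Qed.

End BoundedOperators.

Section ReducedGroupAlgebra.
Context (R : realType) (G : groupType).
Implicit Types (g : G) (f : ell2 R G).

Lemma lambda_sqnorm g f : sqnorm (fun x => f (g^-1 * x)%g) = sqnorm f.
Proof.
rewrite /sqnorm; apply/esym.
apply: (reindex_esum _ _ (fun x => g^-1 * x)%g (fun x => (normc (f x) ^+ 2)%:E)).
split=> //; first by move=> x y _ _; exact: mulgI.
by move=> y _; exists (g * y)%g; rewrite ?mulKg.
Qed.

Lemma lambda_square_summable g f :
  (fun x => f (g^-1 * x)%g) \in @square_summable R G.
Proof.
by apply/square_summableP; rewrite lambda_sqnorm sqnormE ltry.
Qed.

Definition lambda_fun g f : ell2 R G := Ell2 (lambda_square_summable g f).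

Lemma lambda_bounded g : lambda_fun g \in @bounded_linear R G.
Proof.
apply/bounded_linearP; split; first by move=> a f f'; exact: ell2P.
by exists 1 => f; rewrite mul1r /ell2_norm lambda_sqnorm.
Qed.

Definition lambda g : bounded_op R G := BoundedOp (lambda_bounded g).

Lemma lambdaE g f x : lambda g f x = f (g^-1 * x)%g.
Proof. by []. Qed.

Definition reduced_Cstar : set (bounded_op R G) :=
  closure (linear_span (range lambda)).

End ReducedGroupAlgebra.

Arguments reduced_Cstar R G : clear implicits.

Section Ideals.
Context (R : realType) (G : choiceType).
Implicit Types A J : set (bounded_op R G).

(* A is meant to be a closed subalgebra, so that J being closed in the ambient
   algebra is the same as J being closed in A. *)
Definition closed_two_sided_ideal A J : Prop :=
  [/\ J `<=` A, closed J, J 0,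
      (forall (a : R[i]) S T, J S -> J T -> J (a *: S + T)) &
      (forall S T, A S -> J T -> J (S * T) /\ J (T * S))].

Definition simple_Cstar A : Prop :=
  forall J, closed_two_sided_ideal A J -> J = [set 0] \/ J = A.

End Ideals.

Definition centralizer (G : groupType) (x : G) : set G :=
  [set y | commute y x].

Section Free.
Context (G : groupType) (n : nat).

(* A word in the letters x_i (encoded (i, false)) and x_i^-1 ((i, true)). *)
Definition word := seq ('I_n * bool).

(* No two consecutive letters are mutually inverse; the reduced words are the
   elements of the free group on x_0, ..., x_(n-1). *)
Definition reduced : {pred word} :=
  [pred w : word | sorted (fun a b => b != (a.1, ~~ a.2)) w].

Definition word_eval (g : 'I_n -> G) (w : word) : G :=
  (\prod_(a <- w) (if a.2 then (g a.1)^-1 else g a.1))%g.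

(* The canonical morphism from the free group of rank n, sending x_i to g i,
   is injective; in particular the g i are pairwise distinct. *)
Definition free_family (g : 'I_n -> G) : Prop :=
  {in reduced &, injective (word_eval g)}.

End Free.

(* Main.v *)
Require Import Defs.
From HB Require Import structures.
From mathcomp Require Import all_boot all_order all_algebra.
From mathcomp Require Import complex finmap lra.
From mathcomp Require Import all_classical all_reals all_analysis.

Import Order.TTheory GRing.Theory Num.Theory.
Import numFieldNormedType.Exports.

(** Every nonzero closed ideal J is shown to contain the identity, because the
    identity is a limit of averages of translates of one element of J.

    J contains an X whose coefficient at the identity, (X d_1)(1), equals 1: a
    nonzero operator does not vanish on some basis vector (finitely supported
    vectors are dense, [bounded_op_eq0]), and multiplying by translations on
    both sides moves a nonzero matrix entry to the place (1, 1)
    ([ideal_unit_coefficient]).  Approximate X within e by a finite sum Y of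
    a_i lambda(h_i), and apply the hypothesis to the set of the h_i <> 1.  With
    the resulting r, s and c_k, the averages
      T |-> (1/n) sum_k lambda((s r)^-1 c_k s) T lambda(r c_k^-1)
    preserve J, do not increase the norm and fix the identity, since c_k
    commutes with s r.  They send lambda(h), for h one of the h_i <> 1, to
      lambda((s r)^-1) (1/n) sum_k lambda(c_k (s h r) c_k^-1),
    whose norm is at most 2 / sqrt n ([average_contracts]).  For n large the
    average of X is therefore within 3 e of the identity, and J is closed.

    The norm bound 2 sqrt n for a sum of n translations by a free family g
    ([opnorm_sum_free]) comes from a ping-pong decomposition.  Let A_k be the
    set of elements of the group which, relative to a transversal of the right
    cosets of the subgroup generated by g, are given by a reduced word starting
    with g_k.  The A_k are disjoint, so the parts of the lambda(g_k) f supported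
    in A_k are orthogonal, and their sum has norm at most sqrt n |f|.  The
    remaining part of lambda(g_k) f only sees the values of f on
    g_k^-1 (G \ A_k), a set of elements whose word starts with g_k^-1.  These
    sets are disjoint too, so by Cauchy-Schwarz the sum of the remaining parts
    also has norm at most sqrt n |f|. *)

Section SimplicityFromFreeTranslates.
Set Implicit Arguments.
Unset Strict Implicit.
Local Open Scope classical_set_scope.
Local Open Scope ring_scope.
Local Open Scope complex_scope.
Local Notation normc := ComplexField.Normc.normc.

(** * Ping-pong sets of a free family *)

Section PingPong.
Context (G : groupType) (n : nat).
Implicit Types (g : 'I_n -> G) (w : word n) (x y : G).

Lemma word_eval_cons g a w :
  word_eval g (a :: w) =
  ((if a.2 then (g a.1)^-1 else g a.1) * word_eval g w)%g.
Proof. by rewrite /word_eval big_cons. Qed.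

(** Reduction of a word: a new first letter is either kept or cancelled against
    the first letter of the word already reduced. *)
Lemma word_eval_reduced g w :
  exists2 w', w' \in @reduced n & word_eval g w' = word_eval g w.
Proof.
elim: w => [|[i b] w [w' w'r w'E]]; first by exists [::].
rewrite word_eval_cons -w'E; case: w' w'r {w'E} => [|[j c] w'] w'r.
  by exists [:: (i, b)] => //; rewrite word_eval_cons.
have [/eqP jcE|jc] := boolP ((j, c) == (i, ~~ b)).
  exists w'; first by move: w'r; rewrite !inE /= => /path_sorted.
  case: jcE => -> ->; rewrite word_eval_cons mulgA.
  by case: (b); rewrite /= ?mulVg ?mulgV mul1g.
exists [:: (i, b), (j, c) & w']; last by rewrite word_eval_cons.
by move: w'r; rewrite !inE /= jc.
Qed.

(** A representative of the right coset of x modulo the subgroup generated by g;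
    [xget] makes it depend on that coset only. *)
Definition coset_rep g x : G :=
  xget 1%g [set y | exists w, x = (word_eval g w * y)%g].

Lemma coset_repP g x :
  exists2 w, w \in @reduced n & x = (word_eval g w * coset_rep g x)%g.
Proof.
have : [set y | exists w, x = (word_eval g w * y)%g] (coset_rep g x).
  by apply: xgetPex; exists x, [::]; rewrite /word_eval big_nil mul1g.
move=> [w xE]; have [w' w'r w'E] := word_eval_reduced g w.
by exists w' => //; rewrite w'E.
Qed.

Lemma coset_repM g i x : coset_rep g (g i * x)%g = coset_rep g x.
Proof.
congr xget; apply/seteqP; split=> y [w xE].
  exists ((i, true) :: w); rewrite word_eval_cons /= -mulgA -xE.
  by rewrite mulKg.
by exists ((i, false) :: w); rewrite word_eval_cons /= xE mulgA.
Qed.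

(** The ping-pong set A_i: relative to the representatives [coset_rep], the
    reduced word of x starts with the letter g_i. *)
Definition starts_with g i : set G :=
  [set x | exists2 w, (i, false) :: w \in @reduced n &
    x = (word_eval g ((i, false) :: w) * coset_rep g x)%g].

Lemma starts_with_disj g i j x : free_family g ->
  starts_with g i x -> starts_with g j x -> i = j.
Proof.
move=> gfree [w wr xE] [v vr]; rewrite {1}xE => /mulIg /(gfree _ _ wr vr).
by case.
Qed.

(** If the word of x did not start with g_i^-1, prepending g_i would give a
    reduced word of g_i x. *)
Lemma starts_with_inv g i x : ~ starts_with g i (g i * x)%g ->
  exists2 w, (i, true) :: w \in @reduced n &
    x = (word_eval g ((i, true) :: w) * coset_rep g x)%g.
Proof.
move=> gix; have [w wr xE] := coset_repP g x.
have [iw|iw] := boolP ((i, false) :: w \in @reduced n).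
  by case: gix; exists w => //; rewrite word_eval_cons coset_repM -mulgA -xE.
case: w wr iw xE => [//|a w] wr; rewrite inE /= => iw xE.
have : a == (i, true) by apply: contraNT iw => ->; rewrite andTb.
by move=> /eqP aE; exists w; rewrite -aE.
Qed.

Lemma starts_with_inv_disj g i j x : free_family g ->
  ~ starts_with g i (g i * x)%g -> ~ starts_with g j (g j * x)%g -> i = j.
Proof.
move=> gfree /starts_with_inv[w wr xE] /starts_with_inv[v vr].
by rewrite {1}xE => /mulIg /(gfree _ _ wr vr); case.
Qed.

End PingPong.

(** * Truncation of square-summable functions *)

Section Truncation.
Context (R : realType) (G : choiceType).
Implicit Types (S : set G) (f u : ell2 R G).

Lemma le_sqnorm (f g : G -> R[i]) :
  (forall x, normc (f x) <= normc (g x)) -> (sqnorm f <= sqnorm g)%E.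
Proof.
move=> fg; apply: le_esum => x _; rewrite lee_fin.
by rewrite ler_sqr ?nnegrE ?normc_ge0.
Qed.

Lemma truncation_square_summable S f :
  (fun x => if x \in S then f x else 0) \in @square_summable R G.
Proof.
apply/square_summableP; apply: (@le_lt_trans _ _ (sqnorm f)).
  apply: le_sqnorm => x; case: ifP => // _.
  by rewrite ComplexField.Normc.normc0 normc_ge0.
by rewrite sqnormE ltry.
Qed.

(** The orthogonal projection of f onto the functions supported in S. *)
Definition truncation S f : ell2 R G := Ell2 (truncation_square_summable S f).

Lemma truncationE S f x : truncation S f x = if x \in S then f x else 0.
Proof. by []. Qed.

Lemma ell2_sumE (I : Type) (r : seq I) (F : I -> ell2 R G) x :
  (\sum_(i <- r) F i) x = \sum_(i <- r) F i x.
Proof. exact: (big_morph (fun u : ell2 R G => u x)). Qed.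

Lemma truncationC S f : f = truncation S f + truncation (~` S) f.
Proof.
apply: ell2P => x; rewrite -[RHS]/(truncation S f x + truncation (~` S) f x).
rewrite !truncationE in_setC.
by case: (x \in S); rewrite /= ?addr0 ?add0r.
Qed.

Section Disjoint.
Context (n : nat) (S : 'I_n -> set G)
  (disjS : forall i j x, S i x -> S j x -> i = j).

(** At each point at most one of disjoint sets contributes; this is what makes
    the next two norm estimates hold pointwise. *)
Lemma disjoint_family_sum (V : nmodType) (F : 'I_n -> V) x :
  (exists2 k, S k x & \sum_(i < n) (if x \in S i then F i else 0) = F k) \/
  ((forall k, ~ S k x) /\ \sum_(i < n) (if x \in S i then F i else 0) = 0).
Proof.
have [[k Sk]|nS] := pselect (exists k, S k x).
  left; exists k => //; rewrite (bigD1 k)//= mem_set// big1 ?addr0// => i ik.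
  by rewrite memNset// => Si; rewrite (disjS Si Sk) eqxx in ik.
right; split=> [k Sk|]; first by apply: nS; exists k.
by rewrite big1// => i _; rewrite memNset// => Si; apply: nS; exists i.
Qed.

Lemma sum_norm_truncation f :
  \sum_(i < n) ell2_norm (truncation (S i) f) ^+ 2 <= ell2_norm f ^+ 2.
Proof.
rewrite -lee_fin -sqnormE.
have -> : (\sum_(i < n) ell2_norm (truncation (S i) f) ^+ 2)%:E =
          (\sum_(i < n) sqnorm (truncation (S i) f))%E.
  by rewrite -sumEFin; apply: eq_bigr => i _; rewrite sqnormE.
rewrite -esum_sum; last by move=> x i _ _; rewrite lee_fin sqr_ge0.
apply: le_esum => x _; rewrite sumEFin lee_fin.
rewrite (eq_bigr (fun i => if x \in S i then normc (f x) ^+ 2 else 0)); last first.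
  move=> i _; rewrite truncationE; case: ifP => //.
  by rewrite ComplexField.Normc.normc0 expr0n.
case: (disjoint_family_sum (fun=> normc (f x) ^+ 2) x) => [[k _ ->//]|[_ ->]].
by rewrite sqr_ge0.
Qed.

Lemma norm_sum_truncation (F : 'I_n -> ell2 R G) :
  ell2_norm (\sum_(i < n) truncation (S i) (F i)) ^+ 2 <=
  \sum_(i < n) ell2_norm (F i) ^+ 2.
Proof.
rewrite -lee_fin -sqnormE.
have -> : (\sum_(i < n) ell2_norm (F i) ^+ 2)%:E =
          (\sum_(i < n) sqnorm (F i))%E.
  by rewrite -sumEFin; apply: eq_bigr => i _; rewrite sqnormE.
rewrite -esum_sum; last by move=> x i _ _; rewrite lee_fin sqr_ge0.
apply: le_esum => x _; rewrite sumEFin lee_fin ell2_sumE.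
under eq_bigr do rewrite truncationE.
case: (disjoint_family_sum (F ^~ x) x) => [[k _ ->]|[_ ->]].
  by rewrite (bigD1 k)//= lerDl sumr_ge0// => i _; rewrite sqr_ge0.
by rewrite ComplexField.Normc.normc0 expr0n sumr_ge0// => i _; rewrite sqr_ge0.
Qed.

End Disjoint.

Lemma ell2_norm_sum (I : Type) (r : seq I) (F : I -> ell2 R G) :
  ell2_norm (\sum_(i <- r) F i) <= \sum_(i <- r) ell2_norm (F i).
Proof.
elim/big_rec2: _ => [|i x y _ xy].
  by rewrite -(scale0r (0 : ell2 R G)) ell2_normZ ComplexField.Normc.normc0 mul0r.
by rewrite (le_trans (ell2_normD _ _))// lerD2l.
Qed.

Lemma sqr_sum_le (n : nat) (b : 'I_n -> R) :
  (\sum_(i < n) b i) ^+ 2 <= n%:R * \sum_(i < n) b i ^+ 2.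
Proof.
rewrite expr2 big_distrlr /=.
apply: (@le_trans _ _
    (\sum_(i < n) \sum_(j < n) (b i ^+ 2 / 2 + b j ^+ 2 / 2))).
  apply: ler_sum => i _; apply: ler_sum => j _.
  have := sqr_ge0 (b i - b j); nra.
rewrite (eq_bigr (fun i => n%:R * (b i ^+ 2 / 2) + \sum_(j < n) b j ^+ 2 / 2)).
  rewrite big_split /= sumr_const card_ord -[X in _ + X]mulr_natl.
  by rewrite -mulr_sumr -mulr_suml -mulrDr -splitr.
by move=> i _; rewrite big_split /= sumr_const card_ord -[X in X + _]mulr_natl.
Qed.

End Truncation.

(** * Sums of translations by a free family *)

Section FreeNorm.
Context (R : realType) (G : groupType).

Lemma ell2_norm_lambda g (f : ell2 R G) : ell2_norm (lambda R g f) = ell2_norm f.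
Proof. by rewrite /ell2_norm lambda_sqnorm. Qed.

Lemma bounded_op_sumE (I : Type) (r : seq I) (F : I -> bounded_op R G)
    (f : ell2 R G) :
  (\sum_(i <- r) F i) f = \sum_(i <- r) F i f.
Proof. exact: (big_morph (fun T : bounded_op R G => T f)). Qed.

(** The terms lambda(g_k) f are split along the ping-pong sets: the parts inside
    these sets are mutually orthogonal, the parts outside are translates of
    truncations of f to disjoint sets. *)
Lemma opnorm_sum_free n (g : 'I_n -> G) : free_family g ->
  opnorm (\sum_(k < n) lambda R (g k)) <= 2 * Num.sqrt n%:R.
Proof.
move=> gfree; apply: opnorm_le => [|f]; first by rewrite mulr_ge0 ?sqrtr_ge0.
have sqE : (Num.sqrt n%:R * ell2_norm f) ^+ 2 = n%:R * ell2_norm f ^+ 2.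
  by rewrite exprMn (sqr_sqrtr (ler0n R n)).
rewrite bounded_op_sumE.
under eq_bigr => k _ do rewrite (truncationC (starts_with g k) (lambda R (g k) f)).
rewrite big_split /= mulr2n mulrDl mul1r mulrDl.
apply: le_trans (ell2_normD _ _) _; apply: lerD.
  rewrite -ler_sqr ?nnegrE ?mulr_ge0 ?sqrtr_ge0 ?ell2_norm_ge0//.
  rewrite sqE; apply: le_trans (norm_sum_truncation _ _) _.
    by move=> i j x; exact: starts_with_disj.
  under eq_bigr do rewrite ell2_norm_lambda.
  by rewrite sumr_const card_ord mulr_natl.
(* What lies outside A_k comes from the values of f on g_k^-1 (G \ A_k). *)
pose B k := [set x | ~ starts_with g k (g k * x)%g].
rewrite (eq_bigr (fun k => lambda R (g k) (truncation (B k) f))); last first.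
  move=> k _; apply: ell2P => x; rewrite lambdaE !truncationE lambdaE.
  congr (if _ then _ else _).
  by apply/idP/idP; rewrite !inE /B /= mulVKg.
apply: le_trans (ell2_norm_sum _ _) _; under eq_bigr do rewrite ell2_norm_lambda.
rewrite -ler_sqr ?nnegrE ?mulr_ge0 ?sqrtr_ge0 ?ell2_norm_ge0//; last first.
  by rewrite sumr_ge0// => i _; exact: ell2_norm_ge0.
rewrite sqE; apply: le_trans (sqr_sum_le _) _; rewrite ler_wpM2l//.
by apply: sum_norm_truncation => i j x; exact: starts_with_inv_disj.
Qed.

End FreeNorm.

(** * Basis vectors, density and the operator norm *)

Section Density.
Context (R : realType) (G : choiceType).
Implicit Types (S F : set G) (f u : ell2 R G) (T : bounded_op R G).

Lemma sqnorm_delta (g : G) : sqnorm (fun x => (x == g)%:R : R[i]) = 1%E.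
Proof.
rewrite -(@esum_set1 _ _ g (fun=> 1%E)) // esum_mkcond; apply: eq_esum => x _.
rewrite in_set1; case: eqP => _.
  by rewrite [true%:R]mulr1n ComplexField.Normc.normc1 expr1n.
by rewrite [false%:R]mulr0n ComplexField.Normc.normc0 expr0n.
Qed.

Lemma delta_square_summable (g : G) :
  (fun x => (x == g)%:R) \in @square_summable R G.
Proof. by apply/square_summableP; rewrite sqnorm_delta ltry. Qed.

Definition delta (g : G) : ell2 R G := Ell2 (delta_square_summable g).

Lemma deltaE g x : delta g x = (x == g)%:R.
Proof. by []. Qed.

Lemma ell2_norm_delta g : ell2_norm (delta g) = 1.
Proof. by rewrite /ell2_norm sqnorm_delta sqrtr1. Qed.

Lemma normc_le_ell2_norm f x : normc (f x) <= ell2_norm f.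
Proof.
rewrite -ler_sqr ?nnegrE ?normc_ge0 ?ell2_norm_ge0// -lee_fin -sqnormE.
apply: esum_ge; exists [set x]; last by rewrite fsbig_set1.
by split=> //; exact: finite_set1.
Qed.

Lemma truncation_finite F f : finite_set F ->
  truncation F f = \sum_(g <- fset_set F) f g *: delta g.
Proof.
move=> finF; apply: ell2P => x; rewrite ell2_sumE truncationE.
rewrite (eq_bigr (fun g => f g * (x == g)%:R)); last by [].
case: ifPn => [xF|xF].
  rewrite (bigD1_seq x) ?fset_uniq ?in_fset_set//= eqxx mulr1 big1 ?addr0//.
  by move=> g gx; rewrite eq_sym (negbTE gx) mulr0.
rewrite big_seq big1// => g; rewrite in_fset_set// => gF.
by case: eqP => [xg|]; [rewrite xg gF in xF|rewrite mulr0].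
Qed.

Lemma truncation_pythagoras S f :
  ell2_norm f ^+ 2 =
  ell2_norm (truncation S f) ^+ 2 + ell2_norm (truncation (~` S) f) ^+ 2.
Proof.
apply/eqP; rewrite -eqe EFinD -!sqnormE; apply/eqP.
rewrite /sqnorm -esumD; do ?by move=> x _; rewrite lee_fin sqr_ge0.
apply: eq_esum => x _; rewrite !truncationE in_setC if_neg -EFinD.
by case: ifP => _; rewrite ComplexField.Normc.normc0 expr0n /= ?addr0 ?add0r.
Qed.

Lemma finite_support_dense f (e : R) : 0 < e ->
  exists2 F, finite_set F & ell2_norm (truncation (~` F) f) <= e.
Proof.
move=> e0; have e20 : 0 < e ^+ 2 by rewrite exprn_gt0.
have fin : sqnorm f \is a fin_num by rewrite sqnormE.
have [_ [F [finF _] <-] Fe] := ub_ereal_sup_adherent e20 fin.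
exists F => //.
have FE : (\sum_(x \in F) (normc (f x) ^+ 2)%:E)%E =
          (ell2_norm (truncation F f) ^+ 2)%:E.
  rewrite -sqnormE -esum_fset//; last by move=> x _; rewrite lee_fin sqr_ge0.
  rewrite esum_mkcond; apply: eq_esum => x _; rewrite truncationE.
  by case: ifP => //; rewrite ComplexField.Normc.normc0 expr0n.
move: Fe; rewrite FE -[ereal_sup _]/(sqnorm f) sqnormE -EFinB lte_fin.
rewrite (truncation_pythagoras F f) => Fe.
by rewrite -ler_sqr ?nnegrE ?ell2_norm_ge0 ?(ltW e0)//; lra.
Qed.

Lemma bounded_op_eq0 T : (forall g, T (delta g) = 0) -> T = 0.
Proof.
move=> Td; apply: bounded_opP => f; apply: ell2_norm0_eq0.
apply/eqP; rewrite eq_le ell2_norm_ge0 andbT; apply/ler_addgt0Pr => e e0.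
have k0 : 0 < opnorm T + 1 by rewrite ltr_wpDl ?opnorm_ge0.
have [F finF Fe] := finite_support_dense f (divr_gt0 e0 k0).
rewrite add0r {1}(truncationC F f) linearD truncation_finite//.
rewrite linear_sum big1 ?add0r/=.
  apply: le_trans (le_opnorm _ _) _.
  apply: (@le_trans _ _ ((opnorm T + 1) * (e / (opnorm T + 1)))).
    by apply: ler_pM; rewrite ?opnorm_ge0 ?ell2_norm_ge0// lerDl.
  by rewrite mulrC divfK ?gt_eqF.
by move=> g _; rewrite linearZ /= Td scaler0.
Qed.

Lemma opnormD (U T : bounded_op R G) : opnorm (U + T) <= opnorm U + opnorm T.
Proof. by rewrite -lecR rmorphD; exact: opnormCD. Qed.

Lemma opnorm_sum (I : Type) (r : seq I) (U : I -> bounded_op R G) :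
  opnorm (\sum_(i <- r) U i) <= \sum_(i <- r) opnorm (U i).
Proof.
elim/big_rec2: _ => [|i x y _ xy].
  by have := opnormZ_le 0 (0 : bounded_op R G);
    rewrite scale0r ComplexField.Normc.normc0 mul0r.
by rewrite (le_trans (opnormD _ _))// lerD2l.
Qed.

Lemma opnormM (U T : bounded_op R G) : opnorm (U * T) <= opnorm U * opnorm T.
Proof.
apply: opnorm_le => [|f]; first by rewrite mulr_ge0 ?opnorm_ge0.
rewrite -[(U * T) f]/(U (T f)) (le_trans (le_opnorm _ _))// -mulrA.
by rewrite ler_wpM2l ?opnorm_ge0 ?le_opnorm.
Qed.

Lemma opnorm1_le : opnorm (1 : bounded_op R G) <= 1.
Proof. by apply: opnorm_le => // f; rewrite mul1r. Qed.

Lemma scale_opAl (a : R[i]) (U T : bounded_op R G) : (a *: U) * T = a *: (U * T).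
Proof. exact: bounded_opP. Qed.

Lemma scale_opAr (a : R[i]) (U T : bounded_op R G) : U * (a *: T) = a *: (U * T).
Proof. by apply: bounded_opP => f; rewrite -[LHS]/(U (a *: T f)) linearZ. Qed.

Lemma opnormB (U T : bounded_op R G) : opnorm (U - T) = opnorm (T - U).
Proof. by have /(congr1 (@complex.Re R)) := distrC U T. Qed.

(** The topology of the operators is that of a norm with values in the complex
    numbers, where a positive radius is a positive real. *)
Lemma closure_opnormP (A : set (bounded_op R G)) T :
  closure A T <-> forall e : R, 0 < e -> exists2 U, A U & opnorm (U - T) < e.
Proof.
split=> [AT e e0|AT B /nbhs_ballP[e /= e0 eB]].
  have e0C : 0 < e%:C :> R[i] by rewrite ltcR.
  have [U [AU TU]] := AT _ (nbhsx_ballx T (e%:C) e0C).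
  exists U => //; move: TU; rewrite -ball_normE /ball_ /= opnormE ltcR.
  by rewrite -opnormB.
move: e0 eB; rewrite ltcE => /andP[/eqP]; case: e => a b /= -> a0 eB.
have [U AU UT] := AT a a0.
exists U; split => //; apply: eB.
by rewrite -ball_normE /ball_ /= opnormE complexr0 ltcR opnormB.
Qed.


End Density.

(** * Averages of translates and ideals *)

Section Averaging.
Context (R : realType) (G : groupType).
Local Notation L := (lambda R).
Local Notation op := (bounded_op R G).

Lemma lambda1 : L (1%g : G) = 1.
Proof.
by apply: bounded_opP => f; apply: ell2P => x; rewrite lambdaE invg1 mul1g.
Qed.

Lemma lambdaM (g h : G) : L (g * h)%g = L g * L h.
Proof.
apply: bounded_opP => f; apply: ell2P => x.
by rewrite -[RHS]/(L g (L h f) x) !lambdaE invgM mulgA.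
Qed.

Lemma opnorm_lambda (g : G) : opnorm (L g) <= 1.
Proof. by apply: opnorm_le => // f; rewrite mul1r ell2_norm_lambda. Qed.

Lemma normc_natV n : normc (n%:R^-1 : R[i]) = n%:R^-1.
Proof.
rewrite ComplexField.Normc.normcV -(rmorph_nat (real_complex R)) /=.
by rewrite expr0n addr0 sqrtr_sqr ger0_norm.
Qed.

Definition average n (u v : 'I_n -> G) (T : op) : op :=
  n%:R^-1 *: \sum_(k < n) L (u k) * T * L (v k).

Section Average.
Context (n : nat) (u v : 'I_n -> G).

Lemma average_linear : linear (average u v).
Proof.
move=> a S T; rewrite /average scalerA [a * _]mulrC -scalerA -scalerDr.
congr (_ *: _).
rewrite scaler_sumr -big_split; apply: eq_bigr => k _ /=.
by rewrite mulrDr mulrDl scale_opAr scale_opAl.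
Qed.

HB.instance Definition _ :=
  GRing.isLinear.Build R[i] op op *:%R (average u v) average_linear.

Lemma opnorm_average T : (0 < n)%N -> opnorm (average u v T) <= opnorm T.
Proof.
move=> n0; apply: le_trans (opnormZ_le _ _) _; rewrite normc_natV.
rewrite ler_pdivrMl ?ltr0n//; apply: le_trans (opnorm_sum _ _) _.
have -> : n%:R * opnorm T = \sum_(k < n) opnorm T.
  by rewrite sumr_const card_ord mulr_natl.
apply: ler_sum => k _; apply: le_trans (opnormM _ _) _.
apply: (@le_trans _ _ (opnorm (L (u k) * T))).
  by rewrite -[leRHS]mulr1 ler_wpM2l ?opnorm_ge0 ?opnorm_lambda.
apply: le_trans (opnormM _ _) _.
by rewrite -[leRHS]mul1r ler_wpM2r ?opnorm_ge0 ?opnorm_lambda.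
Qed.

Lemma average_lambda h :
  average u v (L h) = n%:R^-1 *: \sum_(k < n) L (u k * h * v k)%g.
Proof. by congr (_ *: _); apply: eq_bigr => k _; rewrite !lambdaM. Qed.

Lemma average_lambda_const h g : (0 < n)%N -> (forall k, u k * h * v k = g)%g ->
  average u v (L h) = L g.
Proof.
move=> n0 uv; rewrite average_lambda (eq_bigr (fun=> L g)); last first.
  by move=> k _; rewrite uv.
rewrite sumr_const card_ord -[X in _ *: X]scaler_nat scalerA.
by rewrite mulVf ?scale1r// pnatr_eq0 -lt0n.
Qed.

End Average.

Lemma lambda_reduced_Cstar g : reduced_Cstar R G (L g).
Proof.
apply: subset_closure; exists 1, (fun=> 1), (fun=> L g).
by split=> [_|]; [exists g|rewrite big_ord1 scale1r].
Qed.

Section IdealLemmas.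
Context (J : set op) (Jid : closed_two_sided_ideal (reduced_Cstar R G) J).

Lemma ideal_average n (u v : 'I_n -> G) T : J T -> J (average u v T).
Proof.
move=> JT; have [_ _ J0 Jlin JM] := Jid.
rewrite /average -[_ *: _]addr0; apply: (Jlin) => //.
apply: (big_rec J) => // k S _ JS.
rewrite -[_ * _ * _]scale1r; apply: Jlin => //.
have [] := JM _ _ (@lambda_reduced_Cstar (u k)) JT.
by move=> /(JM _ _ (@lambda_reduced_Cstar (v k)))[].
Qed.

(** A matrix entry (T d_g)(x) <> 0 is moved to the place (1, 1) by lambda(x^-1)
    on the left and lambda(g) on the right. *)
Lemma ideal_unit_coefficient T : J T -> T <> 0 ->
  exists2 X, J X & X (delta R 1%g) 1%g = 1.
Proof.
move=> JT T0; have [_ _ J0 Jlin JM] := Jid.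
have [g [x Tgx]] : exists g x, T (delta R g) x != 0.
  apply: contrapT => nT; apply: T0; apply: bounded_op_eq0 => g.
  apply: ell2P => x; apply/eqP; apply: contrapT => /negP Tgx.
  by apply: nT; exists g, x.
pose X := L x^-1%g * T * L g.
have JX : J X.
  have [] := JM _ _ (@lambda_reduced_Cstar x^-1%g) JT.
  by move=> /(JM _ _ (@lambda_reduced_Cstar g))[].
have XE : X (delta R 1%g) 1%g = T (delta R g) x.
  rewrite -[LHS]/(L x^-1%g (T (L g (delta R 1%g))) 1%g) lambdaE invgK mulg1.
  congr (ell2_fun (bounded_op_fun T _) _); apply: ell2P => y.
  by rewrite lambdaE !deltaE (can2_eq (mulVKg g) (mulKg g)) mulg1.
exists ((T (delta R g) x)^-1 *: X + 0); first exact: Jlin.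
by rewrite addr0 -[LHS]/((T (delta R g) x)^-1 * X (delta R 1%g) 1%g) XE mulVf.
Qed.

End IdealLemmas.

Definition free_translates := forall (H : set G) (n : nat),
  finite_set H -> H !=set0 -> ~ H 1%g -> (0 < n)%N ->
  exists (r s : G) (c : 'I_n -> G),
    (forall k, centralizer (s * r)%g (c k)) /\
    (forall g, H g ->
      free_family (fun k => c k * (s * g * r) * (c k)^-1)%g).

(** One average treats all the elements of H at once: it fixes the identity and
    is small on every other lambda(h).  The left factor (s r)^-1 brings the average
    of lambda(1), which would be lambda(s r), back to the identity. *)
Lemma average_contracts (hG : free_translates) (H : set G) n :
  finite_set H -> (0 < n)%N -> exists u v : 'I_n -> G,
  forall h, H h ->
    opnorm (average u v (L h) - (h == 1%g)%:R *: (1 : op)) <=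
    n%:R^-1 * (2 * Num.sqrt n%:R).
Proof.
move=> finH n0; pose H' := H `\ 1%g.
have [r [s [c [cC cfree]]]] : exists (r s : G) (c : 'I_n -> G),
    (forall k, centralizer (s * r)%g (c k)) /\
    (forall g, H' g -> free_family (fun k => c k * (s * g * r) * (c k)^-1)%g).
  (* The hypothesis only speaks of nonempty sets; if H' is empty any choice
     will do. *)
  have [H'0|/set0P H'0] := eqVneq H' set0.
    exists 1%g, 1%g, (fun=> 1%g); split=> [k|g].
      by rewrite mulg1; exact: commute1.
    by rewrite H'0.
  by apply: hG => //; [exact: finite_setD|move=> [_]; exact].
pose u k := ((s * r)^-1 * (c k * s))%g; pose v k := (r * (c k)^-1)%g.
exists u, v => h Hh; have [->|h1] := eqVneq h 1%g.
  rewrite (average_lambda_const (g := 1%g)) => // [|k].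
    rewrite lambda1 scale1r subrr -(scale0r (1 : op)).
    apply: le_trans (opnormZ_le _ _) _.
    by rewrite ComplexField.Normc.normc0 mul0r
      mulr_ge0 ?invr_ge0 ?mulr_ge0 ?sqrtr_ge0.
  rewrite /u /v mulg1 -!mulgA [(s * (r * _))%g]mulgA [(c k * _)%g]mulgA.
  by rewrite (cC k) mulgK mulVg.
rewrite scale0r subr0 average_lambda.
rewrite (eq_bigr (fun k =>
  L (s * r)^-1%g * L (c k * (s * h * r) * (c k)^-1)%g)); last first.
  by move=> k _; rewrite -lambdaM /u /v !mulgA.
rewrite -mulr_sumr; apply: le_trans (opnormZ_le _ _) _; rewrite normc_natV.
rewrite ler_wpM2l// (le_trans (opnormM _ _))//.
apply: (@le_trans _ _ (1 * (2 * Num.sqrt n%:R))); last by rewrite mul1r.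
apply: ler_pM; [exact: opnorm_ge0|exact: opnorm_ge0|exact: opnorm_lambda|].
by apply: opnorm_sum_free; apply: cfree; split=> //; exact/eqP.
Qed.

(** By linearity an average of a finite sum Y of a_i lambda(h_i) is, up to
    (sum_i |a_i|) 2 / sqrt n, the multiple of the identity by the coefficient of
    Y at the identity. *)
Lemma average_span (hG : free_translates) (Y : op) (e : R) :
  linear_span (range (@lambda R G)) Y -> 0 < e ->
  exists n (u v : 'I_n -> G), (0 < n)%N /\
    opnorm (average u v Y - Y (delta R 1%g) 1%g *: (1 : op)) <= e.
Proof.
move=> [m [a [s [sL YE]]]] e0.
have /choice[h hE] : forall i, exists h, L h = s i.
  by move=> i; have [h _ <-] := sL i; exists h.
pose M := \sum_(i < m) normc (a i).
have M0 : 0 <= M by rewrite sumr_ge0// => i _; exact: normc_ge0.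
have [d d0 Md] : exists2 d, 0 < d & M * d <= e.
  exists (e / (M + 1)); first by rewrite divr_gt0// ltr_wpDl.
  by rewrite mulrCA ger_pMr// ler_pdivrMr ?mul1r ?lerDl// ltr_wpDl.
have [n nd] : exists n, (2 / d) ^+ 2 < n%:R.
  by exists (Num.bound ((2 / d) ^+ 2)); apply: archi_boundP; rewrite sqr_ge0.
have n0 : (0 < n)%N by rewrite -(ltr0n R) (le_lt_trans _ nd) ?sqr_ge0.
have sqn : n%:R^-1 * (2 * Num.sqrt n%:R) <= d.
  have q0 : 0 < Num.sqrt (n%:R : R) by rewrite sqrtr_gt0 ltr0n.
  have q2 : 2 / d <= Num.sqrt n%:R.
    rewrite -ler_sqr ?nnegrE ?divr_ge0 ?(ltW d0) ?(ltW q0)//.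
    by rewrite sqr_sqrtr// ltW.
  rewrite ler_pdivrMr// in q2.
  have qq : Num.sqrt (n%:R : R) * Num.sqrt n%:R = n%:R.
    by rewrite -expr2 sqr_sqrtr.
  rewrite ler_pdivrMl ?ltr0n// -[in leRHS]qq -mulrA [leLHS]mulrC.
  by rewrite ler_wpM2l// ltW.
have finh : finite_set (range h) by exact: finite_image finite_finset.
have [u [v uv]] := average_contracts hG finh n0.
exists n, u, v; split => //.
have cE : Y (delta R 1%g) 1%g = \sum_(i < m) a i * (h i == 1%g)%:R.
  rewrite YE bounded_op_sumE ell2_sumE; apply: eq_bigr => i _.
  rewrite -hE -[LHS]/(a i * L (h i) (delta R 1%g) 1%g) lambdaE deltaE mulg1.
  by rewrite invg_eq1.
rewrite cE YE linear_sum scaler_suml -sumrB.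
apply: le_trans (opnorm_sum _ _) _.
apply: (@le_trans _ _ (\sum_(i < m) normc (a i) * d)); last first.
  by rewrite -mulr_suml.
apply: ler_sum => i _; rewrite linearZ /= -scalerA -scalerBr.
apply: le_trans (opnormZ_le _ _) _; rewrite ler_wpM2l ?normc_ge0//.
by rewrite -hE (le_trans _ sqn)//; apply: uv; exists i.
Qed.

(** The average of X differs from 1 by three errors, each at most |X - Y|
    or the given e / 4: the average of X - Y, the error of the average of Y, and
    the defect of the coefficient of Y, which that of X, equal to 1, controls. *)
Lemma ideal_contains_id (hG : free_translates) (J : set op) :
  closed_two_sided_ideal (reduced_Cstar R G) J -> J <> [set 0] -> J 1.
Proof.
move=> Jid Jn0; have [JA Jclosed J0 _ _] := Jid.
have [T [JT T0]] : exists T, J T /\ T <> 0.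
  apply: contrapT => nT; apply: Jn0; apply/seteqP; split=> [T JT|_ ->//].
  by apply: contrapT => T0; apply: nT; exists T.
have [X JX X1] := ideal_unit_coefficient Jid JT T0.
rewrite (closure_id J).1//; apply/closure_opnormP => e e0.
have e4 : 0 < e / 4 by rewrite divr_gt0.
have [Y Yspan YX] := (closure_opnormP _ _).1 (JA _ JX) _ e4.
have [n [u [v [n0 uvY]]]] := average_span hG Yspan e4.
exists (average u v X); first exact: ideal_average.
set c := Y _ _ in uvY.
have cX : normc (c - 1) <= opnorm (Y - X).
  have -> : c - 1 = (Y - X) (delta R 1%g) 1%g by rewrite -X1.
  rewrite (le_trans (normc_le_ell2_norm _ _))// -[leRHS]mulr1.
  rewrite -(ell2_norm_delta R (1%g : G)).
  exact: le_opnorm.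
have -> : average u v X - 1 = average u v (X - Y) +
    ((average u v Y - c *: (1 : op)) + (c - 1) *: (1 : op)).
  rewrite linearB /= scalerBl scale1r -!addrA; congr +%R.
  by rewrite addrA addNr add0r addrA addNr add0r.
apply: le_lt_trans (opnormD _ _) _.
apply: (@le_lt_trans _ _ (e / 4 + (e / 4 + e / 4))); last by lra.
apply: lerD.
  by rewrite (le_trans (opnorm_average _ _ _ n0))// opnormB ltW.
apply: le_trans (opnormD _ _) _; apply: lerD => //.
apply: le_trans (opnormZ_le _ _) _; rewrite (le_trans _ (ltW YX))//.
by rewrite -[leRHS]mulr1 ler_pM ?normc_ge0 ?opnorm_ge0 ?opnorm1_le.
Qed.

End Averaging.

End SimplicityFromFreeTranslates.

Local Open Scope classical_set_scope.

Theorem mainTheorem3 (R : realType) (G : groupType)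
    (hG : forall (H : set G) (n : nat),
      finite_set H -> H !=set0 -> ~ H 1%g -> (0 < n)%N ->
      exists (r s : G) (c : 'I_n -> G),
        (forall k, centralizer (s * r)%g (c k)) /\
        (forall g, H g ->
          free_family (fun k => c k * (s * g * r) * (c k)^-1)%g)) :
  simple_Cstar (reduced_Cstar R G).
Proof.
move=> J Jid; have [->|/eqP J0] := eqVneq J [set 0]%R; first by left.
right; have [JA _ _ _ JM] := Jid; apply/seteqP; split=> // S AS.
have [JS _] := JM S 1%R AS (ideal_contains_id hG Jid J0).
by rewrite -[S]GRing.mulr1.
Qed.
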